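(* Let $E,G$ be Banach spaces, $B\colon E\times E\to G$ a bounded bilinear map and $(\pi_n)$ a sequence of partitions of $\mathbb R_{\ge0}$. Suppose that $X\in D(\mathbb R_{\ge0},E)$ has weak $B$-quadratic variation $Q_B(X,X)$ and scalar quadratic variation $Q(X)$ along $(\pi_n)$ and that $(\pi_n)$ satisfies Condition (C) for $X$. Then $$\|Q_B(X,X)_t-Q_B(X,X)_s\|_G\le\|B\|\,(Q(X)_t-Q(X)_s)$$ for all $s,t\in\mathbb R_{\ge0}$ with $s\le t$. Consequently, $Q_B(X,X)$ is absolutely continuous with respect to $Q(X)$.
   Context: Banach spaces are real. A partition of $\mathbb R_{\ge0}$ is a set $\pi=\{\,]t_i,t_{i+1}] : i\in\mathbb N\}$ with $0=t_0<t_1<\dots\to\infty$. For $t>0$, $\pi(t)$ is the unique element of $\pi$ containing $t$. $D(\mathbb R_{\ge0},E)$ is the set of càdlàg paths; $\Delta X_t=X_t-X_{t-}$ for $t>0$, $\Delta X_0=0$; for $I=]r,s]$, $\delta X_t(I)=X_{s\wedge t}-X_{r\wedge t}$. Weak $B$-quadratic variation along $(\pi_n)$: a $G$-valued càdlàg path $Q_B(X,X)$ of finite variation (on compact intervals) such that $\sum_{I\in\pi_n}B(\delta X_t(I),\delta X_t(I))\to Q_B(X,X)_t$ weakly in $G$ for every $t\ge0$, and $\Delta Q_B(X,X)_t=B(\Delta X_t,\Delta X_t)$ for all $t$. Scalar quadratic variation along $(\pi_n)$: a real càdlàg increasing path $Q(X)$ with $\sum_{I\in\pi_n}\|\delta X_t(I)\|^2\to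 Q(X)_t$ for every $t\ge0$ and $\Delta Q(X)_t=\|\Delta X_t\|^2$ for all $t$. Let $D(X)=\{t:\Delta X_t\ne0\}$, $D_\varepsilon(X)=\{t:\|\Delta X_t\|>\varepsilon\}$, $J_\varepsilon(X)_t=\sum_{0<s\le t}\Delta X_s1_{D_\varepsilon(X)}(s)$, and $O^+_t(Z,\pi)=\sup_{]r,s]\in\pi}\ \sup_{u,v\in]r,s]\cap[0,t]}\|Z_u-Z_v\|$. $(\pi_n)$ satisfies Condition (C) for $X$ if: (C1) for all $t\ge0$, $\varepsilon>0$ there is $N$ such that $I\cap[0,t]\cap D_\varepsilon(X)$ has at most one element for all $n\ge N$, $I\in\pi_n$; (C2) $\delta X_t(\pi_n(s))\to\Delta X_s$ for all $s\in D(X)$ and $t\ge s$; (C3) for all $t\ge 0$, $\varlimsup_{\varepsilon\downarrow0}\varlimsup_{n\to\infty}O^+_t(X-J_\varepsilon(X),\pi_n)=0$. Absolute continuity is that of the Stieltjes (vector) measure of $Q_B(X,X)$ with respect to the Stieltjes measure of $Q(X)$. *)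

(* Defs.v *)
From HB Require Import structures.
From mathcomp Require Import all_boot all_order all_algebra.
From mathcomp Require Import all_classical all_reals all_analysis.
Set Implicit Arguments.
Unset Strict Implicit.
Unset Printing Implicit Defensive.
Import Order.TTheory GRing.Theory Num.Theory.
Import numFieldNormedType.Exports.
Local Open Scope classical_set_scope.
Local Open Scope ring_scope.

(* A path indexed by the nonnegative reals is represented by a function on the
   whole of R; its values at negative times are never used. *)

(* The partition { ]t_i, t_{i+1}] : i in nat } of the nonnegative reals is
   represented by its sequence of endpoints, and the interval ]t_i, t_{i+1}]
   by its index i. *)
Record time_partition (R : realType) := TimePartition {
  pt :> nat -> R ;
  pt0 : pt 0%N = 0 ;
  pt_incr : forall i, pt i < pt i.+1 ;
  pt_cvg : pt @ \oo --> +oo }.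

Definition cell (R : realType) (p : time_partition R) (i : nat) : set R :=
  `]p i, p i.+1]%classic.

(* Index of the interval pi(t); the default value 0 is not reached for t > 0. *)
Definition cell_at (R : realType) (p : time_partition R) (t : R) : nat :=
  xget 0%N [set i | cell p i t].

Section paths.
Context {R : realType} {E : normedModType R}.
Implicit Types (X Z : R -> E) (p : time_partition R) (pi : nat -> time_partition R).

Definition cadlag X : Prop :=
  (forall t : R, 0 <= t -> X @ t^'+ --> X t) /\
  (forall t : R, 0 < t -> cvg (X @ t^'-)).

Definition jump X (t : R) : E := if 0 < t then X t - lim (X @ t^'-) else 0.

(* The increment over the i-th interval; it vanishes as soon as t <= p i, so the
   sums over a partition below, written as series, have finitely many nonzero
   terms. *)
Definition increment X p (i : nat) (t : R) : E :=
  X (Num.min (p i.+1) t) - X (Num.min (p i) t).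

Definition jump_times X : set R := [set t | jump X t != 0].

Definition big_jump_times X (eps : R) : set R := [set t | eps < `|jump X t|].

(* For X cadlag and 0 < eps the index set is finite; the sum over an infinite
   set would be 0. *)
Definition big_jumps X (eps : R) (t : R) : E :=
  \sum_(s \in `]0, t]%classic `&` big_jump_times X eps) jump X s.

(* The value 0 is adjoined so that the supremum of no oscillations (as when
   t = 0) is 0 and not -oo. *)
Definition oscillation Z p (t : R) : \bar R :=
  ereal_sup (0%E |` [set x | exists i u v,
    [/\ (cell p i `&` `[0, t]) u, (cell p i `&` `[0, t]) v &
        x = `|Z u - Z v|%:E]]).

Definition condition_C1 pi X : Prop :=
  forall t eps : R, 0 <= t -> 0 < eps -> exists N : nat,
    forall n i, (N <= n)%N ->
      is_subset1 (cell (pi n) i `&` `[0, t] `&` big_jump_times X eps).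

Definition condition_C2 pi X : Prop :=
  forall s t : R, jump_times X s -> s <= t ->
    increment X (pi n) (cell_at (pi n) s) t @[n --> \oo] --> jump X s.

Definition condition_C3 pi X : Prop :=
  forall t : R, 0 <= t ->
    limf_esup (fun eps : R =>
      limn_esup (fun n => oscillation (X \- big_jumps X eps) (pi n) t))
      (0 : R)^'+ = 0%E.

Definition condition_C pi X : Prop :=
  [/\ condition_C1 pi X, condition_C2 pi X & condition_C3 pi X].

(* The library's bounded_variation is for real-valued functions only. *)
Definition finite_variation X : Prop :=
  forall T : R, 0 <= T -> exists M : R, forall s : seq R, itv_partition 0 T s ->
    \sum_(x <- zip s (0 :: s)) `|X x.1 - X x.2| <= M.

Definition weakly_converges (u : nat -> E) (l : E) : Prop :=
  forall phi : {linear E -> R^o}, continuous phi ->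
    phi (u n) @[n --> \oo] --> phi l.

End paths.

Record scalar_quadratic_variation (R : realType) (E : normedModType R)
    (pi : nat -> time_partition R) (X : R -> E) (Q : R -> R) : Prop := {
  sqv_cadlag : cadlag (Q : R -> R^o) ;
  sqv_nondecreasing : forall s t : R, 0 <= s -> s <= t -> Q s <= Q t ;
  sqv_cvg : forall t : R, 0 <= t ->
    limn (series (fun i => `|increment X (pi n) i t| ^+ 2)) @[n --> \oo] --> Q t ;
  sqv_jump : forall t : R, 0 <= t -> jump (Q : R -> R^o) t = `|jump X t| ^+ 2 }.

Section bilinear.
Context {R : realType} {E G : normedModType R}.
Implicit Types (B : {bilinear E -> E -> G}).

Definition bounded_bilinear B : Prop :=
  exists M : R, forall x y, `|B x y| <= M * `|x| * `|y|.

Definition bilinear_norm B : R :=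
  sup [set r | exists x y, [/\ `|x| <= 1, `|y| <= 1 & r = `|B x y|]].

Record weak_quadratic_variation B (pi : nat -> time_partition R) (X : R -> E)
    (Q : R -> G) : Prop := {
  wqv_cadlag : cadlag Q ;
  wqv_finite_variation : finite_variation Q ;
  wqv_cvg : forall t : R, 0 <= t ->
    weakly_converges
      (fun n => limn (series (fun i =>
        B (increment X (pi n) i t) (increment X (pi n) i t)))) (Q t) ;
  wqv_jump : forall t : R, 0 <= t -> jump Q t = B (jump X t) (jump X t) }.

End bilinear.

Section stieltjes.
Context {R : realType}.

(* The Stieltjes measure of an increasing right-continuous path Q: Q is first
   extended to R by the constant Q 0, so that no mass is put on ]-oo, 0]. *)
Definition extend_path (Q : R -> R) (t : R) : R := Q (Num.max 0 t).

Lemma extend_path_nondecreasing (Q : R -> R) :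
  (forall s t : R, 0 <= s -> s <= t -> Q s <= Q t) -> nondecreasing (extend_path Q).
Proof.
move=> Qnd s t st; apply: Qnd; first by rewrite le_max lexx.
by rewrite ge_max !le_max lexx st orbT.
Qed.

Lemma extend_path_right_continuous (Q : R -> R) :
  (forall t : R, 0 <= t -> Q @ t^'+ --> Q t) -> right_continuous (extend_path Q).
Proof.
move=> Qrc x; rewrite /extend_path; have [x0|x0] := leP 0 x.
  apply: cvg_trans (Qrc x x0); apply: near_eq_cvg; near=> y.
  have xy : x < y by near: y; exact: nbhs_right_gt.
  by rewrite /= max_r// (le_trans x0)// ltW.
apply: cvg_near_cst; near=> y.
have y0 : y < 0 by near: y; exact: nbhs_right_lt.
by rewrite max_l// ltW.
Unshelve. all: by end_near. Qed.

Definition path_cumulative (Q : R -> R) (Qcadlag : cadlag (Q : R -> R^o))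
    (Qnd : forall s t : R, 0 <= s -> s <= t -> Q s <= Q t) : cumulative R R :=
  HB.pack (extend_path Q) (@isCumulative.Build R _ R (extend_path Q)
    (extend_path_nondecreasing Qnd)
    (extend_path_right_continuous Qcadlag.1)).

Definition path_stieltjes_measure (Q : R -> R)
    (Qcadlag : cadlag (Q : R -> R^o))
    (Qnd : forall s t : R, 0 <= s -> s <= t -> Q s <= Q t) :
    {measure set (measurableTypeR R) -> \bar R} :=
  lebesgue_stieltjes_measure (path_cumulative Qcadlag Qnd).

Context {G : normedModType R}.

Definition bounded_borel (A : set (measurableTypeR R)) : Prop :=
  measurable A /\ exists T : R, A `<=` `[0, T]%classic.

(* m is the Stieltjes vector measure of the path A. As A has finite variation
   on compact intervals only, m is defined on the bounded Borel subsets of the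
   nonnegative reals, and countably additive on those of each [0, T]. *)
Record vector_stieltjes_measure (A : R -> G)
    (m : set (measurableTypeR R) -> G) : Prop := {
  vsm_zero : m [set 0] = 0 ;
  vsm_itv : forall s t : R, 0 <= s -> s <= t -> m `]s, t]%classic = A t - A s ;
  vsm_sigma_additive : forall F : nat -> set (measurableTypeR R),
    (forall i, measurable (F i)) -> trivIset setT F ->
    bounded_borel (\bigcup_i F i) ->
    (\sum_(0 <= i < n) m (F i)) @[n --> \oo] --> m (\bigcup_i F i) }.

Definition vector_null_dominates (m : set (measurableTypeR R) -> G)
    (mu : {measure set (measurableTypeR R) -> \bar R}) : Prop :=
  forall A, bounded_borel A -> mu A = 0%E -> m A = 0.

(* The Stieltjes vector measure of A, which is unique on bounded Borel sets,
   exists and is absolutely continuous with respect to mu. *)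
Definition stieltjes_abs_continuous (A : R -> G)
    (mu : {measure set (measurableTypeR R) -> \bar R}) : Prop :=
  (exists m, vector_stieltjes_measure A m) /\
  (forall m, vector_stieltjes_measure A m -> vector_null_dominates m mu).

End stieltjes.

(* Main.v *)
(* Test against a norming functional [phi] with [|phi x| <= |x|]. In the
   difference of the approximating sums at [t] and [s], the cells before [s]
   cancel and those after [s] are bounded by the corresponding squares; only the
   cell containing [s] needs (C). By (C3) the path is nearly constant there up to
   its big jumps, of which there is at most one by (C1), so either the increment
   over the part after [s] or the increment over the part before [s] is small.

   For the absolute continuity, [c Q - phi QB] is an increasing path for each
   [phi], so [phi QB] has a signed measure, dominated by [c dQ]. The Borel sets on
   which these signed measures are represented by a single vector of [G] form a
   Dynkin system: the vector representing a disjoint union is the sum of a series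
   that converges absolutely because of the domination. *)
Require Import Defs.
From HB Require Import structures.
From mathcomp Require Import all_boot all_order all_algebra.
From mathcomp Require Import all_classical all_reals all_analysis.
From mathcomp Require Import lra.
Import Order.TTheory GRing.Theory Num.Theory.
Import numFieldNormedType.Exports.
Local Open Scope classical_set_scope.
Local Open Scope ring_scope.

(** * Norming functionals by the Hahn-Banach theorem *)

Section hahn_banach.
Context {R : realType} {V : normedModType R}.
Implicit Types (x y v : V) (r s a : R) (A : set (V * R)).

Let functional_graph A : Prop :=
  (forall a p q, A p -> A q -> A (a *: p.1 + q.1, a * p.2 + q.2)) /\
  (forall p, A p -> p.2 <= `|p.1|).

(** A value at [x0] is admissible when it lies above all numbers [p.2 - |p.1 - x0|] and below all
    numbers [|q.1 + x0| - q.2]. The triangle inequality puts each of the former below each of the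
    latter, so the supremum [s] of the former works. Homogeneity reduces a multiple [a *: x0] with
    [a] nonzero to the coefficients 1 and -1. *)
Let graph_extension A x0 : functional_graph A -> A (0, 0) ->
  exists2 A', functional_graph A' & A `<=` A' /\ exists r, A' (x0, r).
Proof.
move=> [Alin Ale] A0.
have ub p q : A p -> A q -> p.2 - `|p.1 - x0| <= `|q.1 + x0| - q.2.
  move=> Ap Aq; rewrite lerBlDr addrAC lerBrDr.
  have /Ale/= := Alin 1 _ _ Ap Aq; rewrite scale1r mul1r => /le_trans; apply.
  by rewrite [leRHS]addrC (le_trans _ (ler_normD _ _))// addrACA addNr addr0.
pose S := [set p.2 - `|p.1 - x0| | p in A].
have S0 : S !=set0 by exists (0 - `|0 - x0|); exists (0, 0).
have Sub q : A q -> ubound S (`|q.1 + x0| - q.2).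
  by move=> Aq _ [p Ap <-]; exact: ub.
pose s := sup S.
have s_ge p : A p -> p.2 - s <= `|p.1 - x0|.
  move=> Ap; rewrite lerBlDr -lerBlDl; apply: ub_le_sup; last by exists p.
  by exists (`|0 + x0| - 0); exact: (Sub (0, 0)).
have s_le q : A q -> q.2 + s <= `|q.1 + x0|.
  by move=> Aq; rewrite -lerBrDl; apply: ge_sup => //; exact: Sub.
have AZ a p : A p -> A (a *: p.1, a * p.2).
  by move=> Ap; have := Alin a _ _ Ap A0; rewrite /= !addr0.
exists [set (p.1 + a *: x0, p.2 + a * s) | p in A & a in setT].
  split=> /=.
    move=> a _ _ [p Ap [b _ <-]] [q Aq [c _ <-]].
    exists (a *: p.1 + q.1, a * p.2 + q.2); first exact: Alin.
    exists (a * b + c) => //=; congr pair.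
      by rewrite scalerDl scalerDr scalerA addrACA.
    by rewrite mulrDl mulrDr mulrA addrACA.
  move=> _ [p Ap [a _ <-]]/=.
  have [a0|a0|->] := ltgtP a 0; last by rewrite mul0r scale0r !addr0; exact: Ale.
    have b0 : 0 < - a by rewrite oppr_gt0.
    have /s_ge/= := AZ (- a)^-1 _ Ap.
    rewrite -(ler_pM2l b0) -[X in _ <= X * _](gtr0_norm b0) -normrZ scalerBr scalerA mulrBr.
    by rewrite mulrA mulfV ?gt_eqF// mul1r scale1r mulNr scaleNr !opprK.
  have /s_le/= := AZ a^-1 _ Ap.
  rewrite -(ler_pM2l a0) -[X in _ <= X * _](gtr0_norm a0) -normrZ scalerDr scalerA mulrDr.
  by rewrite mulrA mulfV ?gt_eqF// mul1r scale1r.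
split.
  by move=> [x r] Ap; exists (x, r) => //; exists 0 => //; rewrite
    scale0r mul0r !addr0.
by exists s; exists (0, 0) => //; exists 1 => //; rewrite scale1r mul1r !add0r.
Qed.

(* Zorn on the graphs of the linear functionals on subspaces that are dominated
   by the norm; the bound alone forces such a linear relation to be a function. *)
Lemma hahn_banach_norming v :
  exists phi : {linear V -> R^o}, (forall x, `|phi x| <= `|x|) /\ phi v = `|v|.
Proof.
(* The value at [v] is prescribed for nonempty graphs only, so that the union of the empty chain
   still satisfies [P]. *)
pose P A := functional_graph A /\ (A !=set0 -> A (v, `|v|)).
have [F FP Ftot|A [[[Alin Ale] Av] Amax]] := @Zorn_bigcup _ P.
  split; last first.
    by move=> [p [A FA Ap]]; exists A => //; apply: (FP _ FA).2; exists p.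
  split; last by move=> p [A FA Ap]; exact: (FP _ FA).1.2.
  move=> a p q [A FA Ap] [A' FA' A'q].
  have [AA'|A'A] := Ftot _ _ FA FA'.
    by exists A' => //; apply: (FP _ FA').1.1 => //; exact: AA'.
  by exists A => //; apply: (FP _ FA).1.1 => //; exact: A'A.
have {}Av : A (v, `|v|).
  apply: Av; apply/set0P/negP => /eqP A0.
  (* The empty graph is not maximal, since the multiples of [(v, |v|)] form a larger one. *)
  apply: (Amax [set (a *: v, a * `|v|) | a in setT]).
    rewrite A0; split; first exact: sub0set.
    by move=> /(_ _ (ex_intro2 _ _ 0 I erefl)).
  split; last by move=> _; exists 1 => //; rewrite scale1r mul1r.
  split=> [a _ _ [b _ <-] [c _ <-]|_ [a _ <-]]/=.
    by exists (a * b + c) => //; rewrite scalerDl mulrDl scalerA mulrA.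
  by rewrite normrZ ler_wpM2r// ler_norm.
have AgraphA : functional_graph A by [].
have A0 : A (0, 0).
  have := Alin (- 1) _ _ Av Av => /=; by rewrite scaleN1r mulN1r !addNr.
have Atot x : exists r, A (x, r).
  have [A' gA' [AA' [r A'r]]] := graph_extension A x AgraphA A0.
  exists r; apply: contrapT => Ar; apply: (Amax A'); last first.
    by split => // _; exact: AA'.
  by split => // A'A; apply: Ar; exact: A'A.
have Auniq x r r' : A (x, r) -> A (x, r') -> r = r'.
  move=> Ar Ar'; apply/eqP; rewrite eq_le -subr_le0 -[X in _ && X]subr_le0.
  have /Ale := Alin (- 1) _ _ Ar Ar'; have /Ale := Alin (- 1) _ _ Ar' Ar.
  by rewrite /= !scaleN1r !addNr normr0 !mulN1r addrC => ->; rewrite addrC.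
have [f0 Af0] := choice Atot.
pose f : V -> R^o := f0; have Af x : A (x, f x) := Af0 x.
have flin : linear f.
  move=> a x y; apply: (Auniq (a *: x + y)); first exact: Af.
  exact: (Alin a _ _ (Af x) (Af y)).
pose fM := GRing.isLinear.Build _ _ _ _ _ flin.
pose phi : {linear V -> R^o} := HB.pack f fM.
exists phi; split; last by apply: (Auniq v) => //; exact: Af.
move=> x; have phile y : phi y <= `|y| by exact: (Ale _ (Af y)).
rewrite ler_norml phile andbT lerNl.
by have := phile (- x); rewrite normrN linearN.
Qed.

Lemma norming_functionals_separate v :
  (forall phi : {linear V -> R^o}, (forall x, `|phi x| <= `|x|) -> phi v = 0) ->
  v = 0.
Proof.
have [phi [phi1 phiv]] := hahn_banach_norming v.
by move=> /(_ _ phi1); rewrite phiv => /eqP; rewrite normr_eq0 => /eqP.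
Qed.

Lemma contractive_functional_continuous (phi : {linear V -> R^o}) :
  (forall x, `|phi x| <= `|x|) -> continuous phi.
Proof.
move=> phi1; apply/linear_bounded_continuous/bounded_funP => r.
by exists r => x xr; exact: le_trans (phi1 x) xr.
Qed.

End hahn_banach.

(** * The norm of a bounded bilinear map *)

Section bilinear_norm_theory.
Context {R : realType} {E G : normedModType R} (B : {bilinear E -> E -> G}).
Hypothesis B_bounded : bounded_bilinear B.

Let norms_has_ubound :
  has_ubound [set r | exists x y, [/\ `|x| <= 1, `|y| <= 1 & r = `|B x y|]].
Proof.
have [M BM] := B_bounded; exists `|M| => _ [x [y [x1 y1 ->]]].
rewrite (le_trans (BM x y))// -mulrA.
rewrite (@le_trans _ _ (`|M| * (`|x| * `|y|)))//.
  by rewrite ler_wpM2r ?mulr_ge0// ler_norm.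
by rewrite ler_piMr// mulr_ile1.
Qed.

Lemma bilinear_norm_ge0 : 0 <= bilinear_norm B.
Proof.
apply: ub_le_sup => //; exists 0, 0.
by rewrite !normr0 linear0l normr0; split.
Qed.

Lemma bilinear_norm_ub x y : `|B x y| <= bilinear_norm B * (`|x| * `|y|).
Proof.
have [->|x0] := eqVneq x 0; first by rewrite linear0l !normr0 mul0r mulr0.
have [->|y0] := eqVneq y 0; first by rewrite linear0r !normr0 !mulr0.
have nx0 : 0 < `|x| by rewrite normr_gt0.
have ny0 : 0 < `|y| by rewrite normr_gt0.
rewrite -ler_pdivrMr ?mulr_gt0//; apply: ub_le_sup => //.
exists (`|x|^-1 *: x), (`|y|^-1 *: y).
have unit_norm (V : normedModType R) (z : V) : 0 < `|z| -> `| `|z|^-1 *: z| = 1.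
  by move=> z0; rewrite normrZ normfV normr_id mulVf ?gt_eqF.
split; rewrite ?unit_norm// linearZl_LR linearZr_LR !normrZ !normfV !normr_id.
by rewrite invfM mulrC mulrA.
Qed.

End bilinear_norm_theory.

(** * Cells of a partition and increments over them *)

Section time_partition_theory.
Context {R : realType}.
Implicit Types (p : time_partition R) (s t : R).

Lemma pt_nondecreasing p : {homo p : i j / (i <= j)%N >-> i <= j}.
Proof. by apply/nondecreasing_seqP => i; exact/ltW/pt_incr. Qed.

Lemma pt_ge0 p i : 0 <= p i.
Proof. by rewrite -(pt0 p); exact: pt_nondecreasing. Qed.

Lemma pt_eventually_ge p t : exists N, forall i, (N <= i)%N -> t <= p i.
Proof. by have [N _ HN] := cvgry_ge (pt_cvg p) t; exists N => i /HN. Qed.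

(** The alternative [s = p k] serves the time [s = 0], which lies in no half-open cell. *)
Lemma cell_exists p s : 0 <= s ->
  exists k, p k <= s <= p k.+1 /\ (s = p k \/ cell p k s).
Proof.
rewrite le_eqVlt => /orP[/eqP <-|s0].
  by exists 0%N; rewrite pt0 lexx pt_ge0; split => //; left.
have ex : exists i, s <= p i.
  by have [N HN] := pt_eventually_ge p s; exists N; exact: HN.
case: (ex_minnP ex) => -[|k] sk kmin; first by rewrite pt0 leNgt s0 in sk.
have ks : p k < s by rewrite ltNge; apply/negP => /kmin; rewrite ltnn.
by exists k; rewrite (ltW ks) sk; split => //; right; rewrite /cell/= in_itv/= ks.
Qed.

Context {E : normedModType R}.
Implicit Types X : R -> E.

Lemma increment_before X p i s t : p i.+1 <= s -> s <= t ->
  increment X p i t = increment X p i s.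
Proof.
move=> ps st; have qs : p i <= s by rewrite (le_trans _ ps)// ltW// pt_incr.
by rewrite /increment !min_l// (le_trans _ st).
Qed.

Lemma increment_after X p i t : t <= p i -> increment X p i t = 0.
Proof.
move=> tp; rewrite /increment !min_r ?subrr//.
by rewrite (le_trans tp)// ltW// pt_incr.
Qed.

End time_partition_theory.

Lemma limn_series_finite {R : realType} {V : normedModType R} (f : nat -> V) K :
  (forall i, (K <= i)%N -> f i = 0) -> limn (series f) = \sum_(0 <= i < K) f i.
Proof.
move=> fK; apply: lim_near_cst => //.
exists K => // n /= Kn; rewrite /series/= (big_cat_nat (leq0n K) Kn)//=.
rewrite [X in _ + X]big_nat_cond [X in _ + X]big1 ?addr0// => i.
by rewrite andbT => /andP[/fK].
Qed.

(** * The cell containing a fixed time under (C1) and (C3) *)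

Section small_increments.
Context {R : realType} {E : normedModType R}.
Variables (pi : nat -> time_partition R) (X : R -> E).
Hypotheses (X_cadlag : cadlag X) (C1 : condition_C1 pi X) (C3 : condition_C3 pi X).

Let big_jumps_eq (eps r s : R) : r <= s ->
  (forall x, big_jump_times X eps x -> x \notin `]r, s]) ->
  big_jumps X eps r = big_jumps X eps s.
Proof.
move=> rs nojump; rewrite /big_jumps; congr (\sum_(_ \in _) _).
apply/seteqP; split=> x []; rewrite /= in_itv/= => /andP[x0 xr] Dx.
  by split => //; rewrite /= in_itv/= x0 (le_trans xr).
split => //; rewrite /= in_itv/= x0 leNgt; apply/negP => rx.
by have := nojump _ Dx; rewrite in_itv/= rx xr.
Qed.

(* A cell contains at most one big jump, so it has none either after [s] or
   before [s]; off the big jumps the path oscillates little. *)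
Lemma cell_increment_dichotomy (s t eta : R) : 0 <= s -> s <= t -> 0 < eta ->
  \forall n \near \oo, forall k,
    pi n k <= s <= pi n k.+1 -> s = pi n k \/ cell (pi n) k s ->
    `|increment X (pi n) k t - increment X (pi n) k s| <= eta \/
    `|increment X (pi n) k s| <= eta.
Proof.
move=> s0 st eta0; have t0 := le_trans s0 st.
have : (0 < eta%:E)%E by rewrite lte_fin.
(* Both upper limits are infima of suprema over the sets of a filter. A strict bound by [eta]
   therefore yields first one level [eps], then a tail of indices [n] on which the oscillation at
   that level is below [eta]. *)
rewrite -(C3 _ t0) => /ereal_inf_lt[_ [V V0 <-] Veta].
have [eps [eps0 Veps]] : exists eps, 0 < eps /\ V eps.
  apply: (@filter_ex _ (0 : R)^'+); near=> e; split; near: e => //.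
  exact: nbhs_right_gt.
have : (limn_esup (fun n => oscillation (X \- big_jumps X eps)%R (pi n) t)
    < eta%:E)%E.
  by apply: le_lt_trans Veta; apply: ereal_sup_ubound; exists eps.
move=> /ereal_inf_lt[_ [W Woo <-] Weta].
have [N HN] := C1 _ _ t0 eps0.
near=> n.
have osc u v k : (cell (pi n) k `&` `[0, t]) u -> (cell (pi n) k `&` `[0, t]) v ->
    big_jumps X eps u = big_jumps X eps v -> `|X u - X v| <= eta.
  move=> uk vk Juv; rewrite -lee_fin (le_trans _ (ltW Weta))//.
  apply: (@le_trans _ _ (oscillation (X \- big_jumps X eps) (pi n) t)).
    apply: ereal_sup_ubound; right; exists k, u, v; split => //=.
    by rewrite Juv opprB subrKA.
  apply: ereal_sup_ubound; exists n => //.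
  by near: n.
have Nn : (N <= n)%N by near: n; exists N.
move=> k /andP[ks sk] [sE|sk'].
  by right; rewrite increment_after -?sE// normr0 ltW.
have ks' : pi n k < s by move: sk'; rewrite /cell/= in_itv/= => /andP[].
have ct : (cell (pi n) k `&` `[0, t]) s by split => //=; rewrite in_itv/= s0.
pose u := Num.min (pi n k.+1) t.
have su : s <= u by rewrite le_min sk.
have cu : (cell (pi n) k `&` `[0, t]) u.
  split; rewrite ?/cell /= in_itv/=; last by rewrite (le_trans s0 su) ge_min lexx orbT.
  by rewrite (lt_le_trans ks' su) ge_min lexx.
have [[x Dx xs]|nojump] := pselect (exists2 x, big_jump_times X eps x &
    x \in `](pi n k), s]).
  left; rewrite {1}/increment -/u (min_l (le_trans ks st)) /increment.
  rewrite (min_r sk) (min_l ks) opprB addrA subrK.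
  apply: (osc _ _ k) => //; apply/esym/big_jumps_eq => // y Dy.
  apply/negP; rewrite in_itv/= => /andP[sy yu].
  move: xs; rewrite in_itv/= => /andP[kx xs].
  suff xy : x = y by move: sy; rewrite -xy ltNge xs.
  apply: (HN _ k Nn); split => //; split; rewrite ?/cell /= in_itv/=.
  - by rewrite kx (le_trans xs).
  - by rewrite (le_trans (pt_ge0 _ _) (ltW kx)) (le_trans xs).
  - by rewrite (lt_trans ks' sy) (le_trans yu)// ge_min lexx.
  - by rewrite (le_trans s0 (ltW sy)) (le_trans yu)// ge_min lexx orbT.
right; rewrite /increment (min_r sk) (min_l ks).
(* The left endpoint is not in its cell, so the oscillation says nothing about it; it is reached by
   right continuity from points [v] of the cell. *)
have Xr : `|X s - X v| @[v --> (pi n k)^'+] --> `|X s - X (pi n k)|.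
  apply: cvg_norm; apply: cvgB; first exact: cvg_cst.
  exact: X_cadlag.1 (pt_ge0 _ _).
rewrite -(cvg_lim _ Xr)//; apply: limr_le; first by apply/cvg_ex; eexists; exact: Xr.
near=> v.
have kv : pi n k < v by near: v; exact: nbhs_right_gt.
have vs : v <= s by near: v; exact: nbhs_right_ltW.
apply: (osc _ _ k) => //.
  split; rewrite ?/cell /= in_itv/=; first by rewrite kv (le_trans vs).
  by rewrite (le_trans (pt_ge0 _ _) (ltW kv)) (le_trans vs).
apply/esym/big_jumps_eq => // y Dy; apply/negP; rewrite in_itv/= => /andP[vy ys].
by apply: nojump; exists y => //; rewrite in_itv/= (lt_trans kv).
Unshelve. all: by end_near. Qed.

End small_increments.

(** * The inequality tested against one contractive functional *)

Section quadratic_variation_inequality.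
Context {R : realType} {E G : normedModType R} (B : {bilinear E -> E -> G}).
Hypothesis B_bounded : bounded_bilinear B.
Variable phi : {linear G -> R^o}.
Hypothesis phi1 : forall x, `|phi x| <= `|x|.
Let c := bilinear_norm B.

Let phiB_le x y : `|phi (B x y)| <= c * (`|x| * `|y|).
Proof. by rewrite (le_trans (phi1 _))// bilinear_norm_ub. Qed.

(** Contribution of one cell to the approximation of [c * (Q t - Q s) - phi (QB t - QB s)], where
    [a] is the increment of the cell at time [t] and [d] the one at time [s]. *)
Let defect (a d : E) : R :=
  c * (`|a| ^+ 2 - `|d| ^+ 2) - (phi (B a a) - phi (B d d)).

Let defect_ge0 a : 0 <= defect a 0.
Proof.
rewrite /defect linear0l linear0 normr0 expr0n/= !subr0 subr_ge0.
by rewrite (le_trans (ler_norm _))// (le_trans (phiB_le _ _)).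
Qed.

(** If [a - d] is small, then [B a a - B d d = B (a - d) a + B d (a - d)] and the factorization of
    [|d|^2 - |a|^2] each cost at most [2 * C * c * eta]. If [d] is small, the part in [a] is
    nonnegative and the two terms in [d] cost at most [2 * c * eta^2], hence [2 * c * eta] because
    [eta <= 1]. The constant [4 * C + 2] covers both cases. *)
Let defect_lower_bound (C eta : R) (a d : E) : 0 <= eta -> eta <= 1 ->
  `|a| <= C -> `|d| <= C -> `|a - d| <= eta \/ `|d| <= eta ->
  - ((4 * C + 2) * c * eta) <= defect a d.
Proof.
move=> eta0 eta1 aC dC; have c0 : 0 <= c := bilinear_norm_ge0 _ B_bounded.
have C0 : 0 <= C := le_trans (normr_ge0 _) aC.
case=> [ad|dle].
  have Bad : phi (B a a) - phi (B d d) = phi (B (a - d) a) + phi (B d (a - d)).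
    by rewrite linearBl linearBr !linearB /= subrKA.
  have h1 : phi (B (a - d) a) <= c * (eta * C).
    rewrite (le_trans (ler_norm _))// (le_trans (phiB_le _ _))//.
    by rewrite ler_wpM2l// ler_pM.
  have h2 : phi (B d (a - d)) <= c * (C * eta).
    rewrite (le_trans (ler_norm _))// (le_trans (phiB_le _ _))//.
    by rewrite ler_wpM2l// ler_pM.
  have da : `|d| - `|a| <= eta.
    by rewrite (le_trans _ ad)// distrC lerB_dist.
  have h3 : c * (`|d| ^+ 2 - `|a| ^+ 2) <= c * (eta * (C + C)).
    rewrite ler_wpM2l// subr_sqr.
    have [h|h] := leP 0 (`|d| - `|a|); first by apply: ler_pM => //; exact: lerD.
    rewrite (@le_trans _ _ 0) ?mulr_ge0 ?addr_ge0//.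
    by rewrite mulr_le0_ge0 ?addr_ge0// ltW.
  have h4 : 0 <= c * eta by rewrite mulr_ge0.
  rewrite /defect Bad; nra.
have h1 : 0 <= c * `|a| ^+ 2 - phi (B a a).
  by have := defect_ge0 a; rewrite /defect linear0l linear0 normr0 expr0n/= !subr0.
have h2 : - phi (B d d) <= c * (eta * eta).
  rewrite -linearN (le_trans (ler_norm _))// linearN normrN.
  by rewrite (le_trans (phiB_le _ _))// ler_wpM2l// ler_pM.
have h3 : c * `|d| ^+ 2 <= c * (eta * eta).
  by rewrite ler_wpM2l// expr2 ler_pM.
have h4 : c * (eta * eta) <= c * eta by rewrite ler_wpM2l// ler_piMr.
have h5 : 0 <= c * C * eta by rewrite !mulr_ge0.
rewrite /defect; nra.
Qed.


Variables (pi : nat -> time_partition R) (X : R -> E) (QB : R -> G) (Q : R -> R).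
Hypothesis X_cadlag : cadlag X.
Hypothesis hQB : weak_quadratic_variation B pi X QB.
Hypothesis hQ : scalar_quadratic_variation pi X Q.
Hypotheses (C1 : condition_C1 pi X) (C3 : condition_C3 pi X).

Let squares n u := limn (series (fun i => `|increment X (pi n) i u| ^+ 2)).
Let bilinear_squares n u := limn (series (fun i =>
  B (increment X (pi n) i u) (increment X (pi n) i u))).

Let squaresE n u K : u <= pi n K ->
  squares n u = \sum_(0 <= i < K) `|increment X (pi n) i u| ^+ 2.
Proof.
move=> uK; apply: (@limn_series_finite R R^o) => i Ki.
rewrite increment_after ?normr0 ?expr0n//.
by rewrite (le_trans uK)// pt_nondecreasing.
Qed.

Let bilinear_squaresE n u K : u <= pi n K ->
  bilinear_squares n u = \sum_(0 <= i < K)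
    B (increment X (pi n) i u) (increment X (pi n) i u).
Proof.
move=> uK; apply: limn_series_finite => i Ki.
rewrite increment_after ?linear0l//.
by rewrite (le_trans uK)// pt_nondecreasing.
Qed.

(** A single square is at most the whole sum, and [x <= x^2 + 1] avoids a square root. *)
Let increment_le_squares n u i : `|increment X (pi n) i u| <= squares n u + 1.
Proof.
have [N HN] := pt_eventually_ge (pi n) u.
rewrite (@squaresE _ _ (maxn N i.+1)) ?HN ?leq_maxl//.
rewrite big_mkord (bigD1 (Ordinal (leq_maxr N i.+1)))//=.
set x := `|_|; set y := \sum_(_ < _ | _) _.
have y0 : 0 <= y by apply: sumr_ge0 => j _; rewrite exprn_ge0.
have := sqr_ge0 (x - 1); nra.
Qed.

Lemma functional_increment_le s t : 0 <= s -> s <= t ->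
  phi (QB t - QB s) <= c * (Q t - Q s).
Proof.
move=> s0 st; have t0 := le_trans s0 st.
have c0 : 0 <= c := bilinear_norm_ge0 _ B_bounded.
pose w n := c * (squares n t - squares n s) -
  (phi (bilinear_squares n t) - phi (bilinear_squares n s)).
have w_cvg : w n @[n --> \oo] --> c * (Q t - Q s) - (phi (QB t) - phi (QB s)).
  have phic := contractive_functional_continuous _ phi1.
  apply: cvgB; last by apply: cvgB; apply: (wqv_cvg hQB).
  by apply: cvgMr; apply: cvgB; apply: (sqv_cvg hQ).
(* It suffices that [w n] is eventually at least [- delta]. *)
rewrite linearB -subr_ge0; apply/ler_addgt0Pr => delta delta0.
rewrite -lerBlDr sub0r -(cvg_lim _ w_cvg)//.
apply: limr_ge; first by apply/cvg_ex; eexists; exact: w_cvg.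
(* For large [n] the sums of squares exceed [|Q t|] and [|Q s|] by at most 1, and
   [increment_le_squares] adds another 1, so [C] bounds the increments at both times. The summand 1
   in [M] keeps the divisor of [delta] positive. *)
pose C := `|Q t| + `|Q s| + 2.
pose M := (4 * C + 2) * c + 1.
have C0 : 0 <= C by rewrite !addr_ge0.
have M0 : 0 < M by rewrite ltr_wpDl// mulr_ge0// addr_ge0// mulr_ge0.
pose eta := Num.min 1 (delta / M).
have eta0 : 0 < eta by rewrite lt_min ltr01 divr_gt0.
have eta1 : eta <= 1 by rewrite ge_min lexx.
have etaM : (4 * C + 2) * c * eta <= delta.
  rewrite (@le_trans _ _ (M * eta))//.
    by rewrite ler_wpM2r ?(ltW eta0)// lerDl.
  by rewrite mulrC -ler_pdivlMr// ge_min lexx orbT.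
near=> n.
have Qt1 : squares n t <= `|Q t| + 1.
  near: n; apply: (cvgr_le (Q t)); first exact: (sqv_cvg hQ).
  by rewrite ltr_pwDr// ler_norm.
have Qs1 : squares n s <= `|Q s| + 1.
  near: n; apply: (cvgr_le (Q s)); first exact: (sqv_cvg hQ).
  by rewrite ltr_pwDr// ler_norm.
have [k [ksk kcell]] := cell_exists (pi n) _ s0.
have [N HN] := pt_eventually_ge (pi n) t.
(* One range of summation for all four sums: it reaches beyond [t] and contains the index [k]. *)
pose K := maxn N k.+1.
have tK : t <= pi n K by rewrite HN ?leq_maxl.
rewrite /w !(@squaresE _ _ K, @bilinear_squaresE _ _ K)// ?(le_trans st)//.
rewrite !(linear_sum phi) -!sumrB mulr_sumr -sumrB.
set F := BIG_F.
rewrite big_mkord (bigD1 (Ordinal (leq_maxr N k.+1 : (k < K)%N)))//=.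
rewrite -[leLHS]addr0 lerD//; last first.
  apply: sumr_ge0 => i; rewrite -val_eqE/= neq_ltn => /orP[ik|ki].
    rewrite /F (increment_before _ _ _ _ _ _ st) ?subrr ?mulr0 ?subrr//.
    by rewrite (le_trans _ (andP ksk).1)// pt_nondecreasing.
  rewrite /F (increment_after X (pi n) i s) ?defect_ge0//.
  by rewrite (le_trans (andP ksk).2)// pt_nondecreasing.
apply: (@le_trans _ _ (- ((4 * C + 2) * c * eta))); first by rewrite lerN2.
apply: defect_lower_bound => //; first exact: ltW.
- rewrite (le_trans (increment_le_squares _ _ _))// (le_trans (lerD Qt1 (lexx 1)))//.
  by have := normr_ge0 (Q s); rewrite /C; lra.
- rewrite (le_trans (increment_le_squares _ _ _))// (le_trans (lerD Qs1 (lexx 1)))//.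
  by have := normr_ge0 (Q t); rewrite /C; lra.
(* The index [k] depends on [n], so it is generalized before [n] is taken large; the dichotomy is
   uniform in [k]. *)
- move: k ksk kcell {K tK F}; near: n.
  exact: (cell_increment_dichotomy pi X).
Unshelve. all: by end_near. Qed.

End quadratic_variation_inequality.

Lemma weak_quadratic_variation_increment_le {R : realType}
    {E G : normedModType R} (B : {bilinear E -> E -> G})
    (pi : nat -> time_partition R) (X : R -> E) (QB : R -> G) (Q : R -> R) :
  bounded_bilinear B -> cadlag X ->
  weak_quadratic_variation B pi X QB -> scalar_quadratic_variation pi X Q ->
  condition_C1 pi X -> condition_C3 pi X ->
  forall s t, 0 <= s -> s <= t ->
    `|QB t - QB s| <= bilinear_norm B * (Q t - Q s).
Proof.
move=> Bb Xc hQB hQ C1 C3 s t s0 st.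
have [phi [phi1 <-]] := hahn_banach_norming (QB t - QB s).
exact: (functional_increment_le _ Bb _ phi1 pi X).
Qed.

(** * Real values of a measure below a set of finite measure *)

Section finite_real_measure.
Context {d} {T : measurableType d} {R : realType} (mu : {measure set T -> \bar R}).
Variable D : set T.
Hypotheses (mD : measurable D) (muD : (mu D < +oo)%E).

Let measure_fin S : measurable S -> S `<=` D -> mu S \is a fin_num.
Proof.
move=> mS SD; rewrite ge0_fin_numE//; apply: le_lt_trans muD.
by apply: le_measure => //; rewrite inE.
Qed.

Lemma fine_measureD S : measurable S -> S `<=` D ->
  fine (mu (D `\` S)) = fine (mu D) - fine (mu S).
Proof.
move=> mS SD; rewrite measureD// setIidr//.
by rewrite fineB// measure_fin.
Qed.

Lemma fine_measure_bigcup_cvg (F : nat -> set T) :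
  (forall i, measurable (F i)) -> trivIset setT F -> (forall i, F i `<=` D) ->
  (\sum_(0 <= i < n) fine (mu (F i))) @[n --> \oo] --> fine (mu (\bigcup_i F i)).
Proof.
move=> mF tF FD; have mU : measurable (\bigcup_i F i) by exact: bigcup_measurable.
have UD : \bigcup_i F i `<=` D by exact: bigcup_sub.
rewrite (_ : (fun n => _) = fine \o (fun n => (\sum_(0 <= i < n) mu (F i))%E)).
  apply: fine_cvg; rewrite (fineK (measure_fin _ mU UD)).
  exact: (@measure_sigma_additive _ _ _ mu _ mF tF).
by apply/funext => n /=; rewrite sum_fine// => i _; exact: measure_fin.
Qed.

End finite_real_measure.

Lemma path_stieltjes_measure_itv {R : realType} (Q : R -> R)
    (Qcadlag : cadlag (Q : R -> R^o))
    (Qnd : forall s t, 0 <= s -> s <= t -> Q s <= Q t) s t :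
  0 <= s -> s <= t ->
  path_stieltjes_measure Qcadlag Qnd `]s, t]%classic = (Q t - Q s)%:E.
Proof.
move=> s0 st.
rewrite /path_stieltjes_measure/= /lebesgue_stieltjes_measure /measure_extension.
rewrite measurable_mu_extE/=; last exact: is_ocitv.
by rewrite wlength_itv_bnd// /extend_path !max_r// (le_trans s0).
Qed.

(** * The vector Stieltjes measure of a path dominated by an increasing path *)

Section dominated_path.
Context {R : realType} {G : completeNormedModType R}.
Variables (Q : R -> R) (Qcadlag : cadlag (Q : R -> R^o)).
Hypothesis Qnd : forall s t : R, 0 <= s -> s <= t -> Q s <= Q t.
Variables (A : R -> G) (c : R).
Hypothesis Acadlag : cadlag A.
Hypothesis A_le : forall s t : R, 0 <= s -> s <= t -> `|A t - A s| <= c * (Q t - Q s).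

Local Notation borel_set := (set (measurableTypeR R)).
Implicit Types (phi : {linear G -> R^o}) (S : borel_set) (g : G).

Let mu := path_stieltjes_measure Qcadlag Qnd.

Let contractive phi := forall x, `|phi x| <= `|x|.

Let residual phi (t : R) : R := c * Q t - phi (A t).

Let residual_nondecreasing phi (phi1 : contractive phi) s t :
  0 <= s -> s <= t -> residual phi s <= residual phi t.
Proof.
move=> s0 st; rewrite /residual; have := le_trans (phi1 _) (A_le _ _ s0 st).
rewrite linearB => /(le_trans (ler_norm _)) /=; lra.
Qed.

Let residual_cadlag phi (phi1 : contractive phi) :
  cadlag (residual phi : R -> R^o).
Proof.
have phic := contractive_functional_continuous _ phi1.
split=> t t0.
  apply: (@cvgB _ R^o); first by apply: cvgMr; exact: Qcadlag.1.
  by apply: continuous_cvg; [exact: phic|exact: Acadlag.1].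
apply: (@is_cvgB _ R^o); first by apply: is_cvgMr; exact: Qcadlag.2.
have /cvg_ex[l Al] := Acadlag.2 t t0.
by apply/cvg_ex; exists (phi l); apply: continuous_cvg Al; exact: phic.
Qed.

Let nu phi (phi1 : contractive phi) :=
  path_stieltjes_measure (residual_cadlag _ phi1) (residual_nondecreasing _ phi1).

(* [nu] is the measure of the increasing path [c Q - phi A], so this is the
   value at [S] of the signed Stieltjes measure of [phi A]. *)
Let functional_measure phi (phi1 : contractive phi) S : R :=
  c * fine (mu S) - fine (nu _ phi1 S).

Let functional_measure_itv phi (phi1 : contractive phi) s t :
  0 <= s -> s <= t -> functional_measure _ phi1 `]s, t]%classic = phi (A t - A s).
Proof.
move=> s0 st; rewrite /functional_measure /mu /nu !path_stieltjes_measure_itv//=.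
by rewrite /residual linearB /=; lra.
Qed.

Let functional_measure0 phi (phi1 : contractive phi) :
  functional_measure _ phi1 set0 = 0.
Proof. by rewrite /functional_measure !measure0 mulr0 subrr. Qed.

(** Both [mu] and [nu] are finite here. The origin is left out since it carries no mass. *)
Let D (T : R) : borel_set := `]0, T]%classic.

Let mD T : measurable (D T).
Proof. exact: measurable_itv. Qed.

Let finite_on_D T Q' (Q'c : cadlag (Q' : R -> R^o)) Q'nd : 0 <= T ->
  (path_stieltjes_measure Q'c Q'nd (D T) < +oo)%E.
Proof. by move=> T0; rewrite /D path_stieltjes_measure_itv// ltry. Qed.

Let functional_measureD T phi (phi1 : contractive phi) S :
  0 <= T -> measurable S -> S `<=` D T ->
  functional_measure _ phi1 (D T `\` S) =
  functional_measure _ phi1 (D T) - functional_measure _ phi1 S.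
Proof.
move=> T0 mS SD; rewrite /functional_measure.
rewrite !(fine_measureD _ _ (mD T)) ?finite_on_D//.
lra.
Qed.

Let functional_measure_bigcup_cvg T phi (phi1 : contractive phi)
    (F : nat -> borel_set) :
  0 <= T -> (forall i, measurable (F i)) -> trivIset setT F ->
  (forall i, F i `<=` D T) ->
  (\sum_(0 <= i < n) functional_measure _ phi1 (F i)) @[n --> \oo] -->
  functional_measure _ phi1 (\bigcup_i F i).
Proof.
move=> T0 mF tF FD.
rewrite (_ : (fun n => _) = (fun n => c * (\sum_(0 <= i < n) fine (mu (F i))) -
  \sum_(0 <= i < n) fine (nu _ phi1 (F i)))); last first.
  by apply/funext => n; rewrite mulr_sumr -sumrB.
have cvg_measure Q' (Q'c : cadlag (Q' : R -> R^o)) Q'nd :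
    (\sum_(0 <= i < n) fine (path_stieltjes_measure Q'c Q'nd (F i)))
      @[n --> \oo] --> fine (path_stieltjes_measure Q'c Q'nd (\bigcup_i F i)).
  exact: (fine_measure_bigcup_cvg _ _ (mD T) (finite_on_D _ _ _ _ T0)).
by apply: cvgB; [apply: cvgMr|]; exact: cvg_measure.
Qed.

Let represents g S := forall phi (phi1 : contractive phi),
  phi g = functional_measure _ phi1 S.

Let represents_norm_le g S : represents g S -> `|g| <= c * fine (mu S).
Proof.
move=> gS; have [phi [phi1 <-]] := hahn_banach_norming g.
by rewrite (gS _ phi1) gerBl fine_ge0.
Qed.

Let represents_unique g g' S : represents g S -> represents g' S -> g = g'.
Proof.
move=> gS g'S; apply/subr0_eq/norming_functionals_separate => phi phi1.
by rewrite linearB (gS _ phi1) (g'S _ phi1) /= subrr.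
Qed.

(** The convergence to [l] is kept in the conclusion, so that the lemma serves both the Dynkin
    induction and the countable additivity of the vector measure. *)
Let represents_bigcup T (F : nat -> borel_set) (g : nat -> G) :
  0 <= T -> (forall i, measurable (F i)) -> trivIset setT F ->
  (forall i, F i `<=` D T) -> (forall i, represents (g i) (F i)) ->
  exists2 l, represents l (\bigcup_i F i) & series g n @[n --> \oo] --> l.
Proof.
move=> T0 mF tF FD gF.
have mucvg := fine_measure_bigcup_cvg mu _ (mD T) (finite_on_D _ _ _ _ T0) F mF tF FD.
have /normed_cvg gcvg : cvgn [normed series g].
  apply: (@series_le_cvg R (fun i => `|g i|) (fun i => c * fine (mu (F i)))) => //.
  - by move=> i; exact: le_trans (represents_norm_le _ _ (gF i)).
  - by move=> i; exact: represents_norm_le.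
  apply: is_cvg_seriesZ; apply/cvg_ex; eexists; exact: mucvg.
exists (limn (series g)) => // phi phi1.
have phic := contractive_functional_continuous _ phi1.
have h1 : phi (series g n) @[n --> \oo] --> phi (limn (series g)).
  by apply: continuous_cvg => //; exact: phic.
apply: (cvg_unique _ h1) => //.
rewrite (_ : (fun n => _) =
    fun n => \sum_(0 <= i < n) functional_measure _ phi1 (F i)).
  exact: (functional_measure_bigcup_cvg T).
by apply/funext => n; rewrite /series/= linear_sum; apply: eq_bigr => i _; exact: gF.
Qed.

(** The outer maximum keeps the endpoints ordered when the intersection is empty, so that increments
    of the path give the value in every case. *)
Let itv_setI a b T : 0 <= T ->
  `]a, b]%classic `&` D T =
  `](Num.max a 0), (Num.max (Num.max a 0) (Num.min b T))]%classic :> set R.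
Proof.
move=> T0; rewrite /D !set_itvE; apply/seteqP; split=> x /=.
  by case=> /andP[ax xb] /andP[x0 xT]; rewrite gt_max ax x0 le_max le_min xb xT orbT.
rewrite gt_max le_max le_min => /andP[/andP[ax x0]] /orP[|/andP[xb xT]].
  by rewrite leNgt gt_max ax x0.
by rewrite ax xb x0 xT.
Qed.

Let represents_exists T S : 0 <= T -> measurable S ->
  exists g, represents g (S `&` D T).
Proof.
move=> T0; have repD : represents (A T - A 0) (D T).
  by move=> phi phi1; rewrite functional_measure_itv.
apply: (@dynkin_induction _ (measurableTypeR R) (@ocitv R)
  (fun S => exists g, represents g (S `&` D T)) erefl (@ocitvI R)).
- by exists (A T - A 0); rewrite setTI.
- move=> _ [[a b] _ <-] /=; rewrite itv_setI//.
  set a' := Num.max a 0; set b' := Num.max a' (Num.min b T).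
  exists (A b' - A a') => phi phi1; rewrite functional_measure_itv//.
    by rewrite le_max lexx orbT.
  by rewrite le_max lexx.
(* The complement is taken within [D T], which is represented by [A T - A 0]. *)
- move=> B mB [g gB]; exists (A T - A 0 - g) => phi phi1.
  rewrite (_ : ~` B `&` D T = D T `\` (B `&` D T)); last first.
    by rewrite setDIr setDv setU0 setDE setIC.
  rewrite functional_measureD//; first by rewrite linearB repD gB.
  exact: measurableI.
- move=> F mF tF /choice[g gF].
  have [||||l lF _] := represents_bigcup T (fun i => F i `&` D T) g T0; last first.
  - by exists l; rewrite setI_bigcupl.
  - exact: gF.
  - by move=> i; exact: subIsetr.
  - exact: trivIset_setIr.
  - by move=> i; exact: measurableI.
Qed.

(** Cutting with []0, +oo[] instead of some [D T] makes the value independent of a horizon. The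
    default 0 is not reached on bounded Borel sets. *)
Let stieltjes_measure S : G := xget 0 [set g | represents g (S `&` `]0, +oo[%classic)].

Let bounded_setI S T : S `<=` `[0, T]%classic ->
  S `&` `]0, +oo[%classic = S `&` D T.
Proof.
move=> ST; apply/seteqP; split=> x [Sx].
  rewrite /D !set_itvE/= => x0; split => //=.
  by have := ST _ Sx; rewrite /= in_itv/= x0 => /andP[].
by rewrite /D !set_itvE/= => /andP[].
Qed.

Let stieltjes_measureP S T : 0 <= T -> measurable S -> S `<=` `[0, T]%classic ->
  represents (stieltjes_measure S) (S `&` D T).
Proof.
move=> T0 mS ST; rewrite /stieltjes_measure (bounded_setI _ _ ST).
have gS := represents_exists T _ T0 mS.
apply: (@xgetPex _ (0 : G) [set g | represents g (S `&` D T)]); exact: gS.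
Qed.

Let bounded_borel_horizon S : bounded_borel S ->
  exists T, [/\ 0 <= T, measurable S & S `<=` `[0, T]%classic].
Proof.
move=> [mS [T ST]]; exists (Num.max 0 T); split; rewrite ?le_max ?lexx//.
move=> x /ST; rewrite /= !in_itv/= => /andP[-> xT].
by rewrite le_max xT orbT.
Qed.

Lemma dominated_vector_stieltjes_measure_exists :
  exists m, vector_stieltjes_measure A m.
Proof.
exists stieltjes_measure; split.
- apply: (@represents_unique _ _ ([set 0] `&` D 0)).
    apply: stieltjes_measureP => //.
    by move=> x /= ->; rewrite in_itv/= lexx.
  move=> phi phi1; rewrite linear0 (_ : _ `&` _ = set0) ?functional_measure0//.
  by rewrite /D set_itvE setI0.
- move=> s t s0 st; have t0 := le_trans s0 st.
  apply: (@represents_unique _ _ (`]s, t]%classic `&` D t)).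
    apply: stieltjes_measureP => //.
    move=> x; rewrite /= !in_itv/= => /andP[sx ->].
    by rewrite (le_trans s0 (ltW sx)).
  move=> phi phi1; rewrite (_ : _ `&` _ = `]s, t]%classic).
    by rewrite functional_measure_itv.
  apply/setIidPl => x; rewrite /D /= !in_itv/= => /andP[sx ->].
  by rewrite (le_lt_trans s0 sx).
- move=> F mF tF /bounded_borel_horizon[T [T0 mU UT]].
  have FT i : F i `<=` `[0, T]%classic.
    by apply: subset_trans UT; exact: bigcup_sup.
  have [||||l lF Fl] := represents_bigcup T (fun i => F i `&` D T)
      (stieltjes_measure \o F) T0.
  - by move=> i; apply: measurableI.
  - exact: trivIset_setIr.
  - by move=> i; apply: subIsetr.
  - by move=> i; exact: stieltjes_measureP.
  suff -> : stieltjes_measure (\bigcup_i F i) = l by [].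
  apply: represents_unique lF; rewrite -setI_bigcupl.
  exact: stieltjes_measureP.
Qed.


Let additive_of_sigma_additive m S S' : vector_stieltjes_measure A m ->
  measurable S -> measurable S' -> S `&` S' = set0 -> bounded_borel (S `|` S') ->
  m (S `|` S') = m S + m S'.
Proof.
move=> mA mS mS' SS' bSS'; rewrite -bigcup2E in bSS' *.
(* The value at the empty set is read off the interval []0, 0]]; it makes all but two terms of the
   series vanish. *)
have m0 : m set0 = 0 by rewrite -(set_itvoc0 (0 : R)) (vsm_itv mA)// subrr.
have mb i : measurable (bigcup2 S S' i).
  by move: i => [|[|i]] //=; exact: measurable0.
have tb : trivIset setT (bigcup2 S S') by rewrite -trivIset_bigcup2.
have /cvg_lim <- // := vsm_sigma_additive mA mb tb bSS'.
rewrite (@limn_series_finite _ _ (m \o bigcup2 S S') 2).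
  by rewrite !big_nat_recr//= big_geq// add0r.
by move=> [|[|i]] //= _; exact: m0.
Qed.

(** The Dynkin induction is repeated for an arbitrary vector measure of the path, so that the
    domination applies to all of them and not only to the one constructed above. *)
Let vector_stieltjes_measure_represents m T S :
  vector_stieltjes_measure A m -> 0 <= T -> measurable S ->
  represents (m (S `&` D T)) (S `&` D T).
Proof.
move=> mA T0 mS; move: S mS.
have bS S : measurable S -> S `<=` D T -> bounded_borel S.
  move=> mS SD; split => //; exists T; apply: subset_trans SD _ => x.
  by rewrite /D /= !in_itv/= => /andP[/ltW -> ->].
have bSD S : measurable S -> bounded_borel (S `&` D T).
  by move=> mS; apply: bS => //; exact: measurableI.
have repD : represents (m (D T)) (D T).
  by move=> phi phi1; rewrite functional_measure_itv// (vsm_itv mA).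
apply: (@dynkin_induction _ (measurableTypeR R) (@ocitv R)
  (fun S => represents (m (S `&` D T)) (S `&` D T)) erefl (@ocitvI R)).
- by rewrite setTI.
- move=> _ [[a b] _ <-] /= phi phi1; rewrite itv_setI//.
  have a0 : 0 <= Num.max a 0 by rewrite le_max lexx orbT.
  have ab : Num.max a 0 <= Num.max (Num.max a 0) (Num.min b T).
    by rewrite le_max lexx.
  by rewrite functional_measure_itv// (vsm_itv mA).
- move=> B mB gB phi phi1.
  have BE : ~` B `&` D T = D T `\` (B `&` D T).
    by rewrite setDIr setDv setU0 setDE setIC.
  rewrite BE functional_measureD//; last exact: measurableI.
  rewrite -repD -gB -linearB; congr (phi _); apply/eqP; rewrite eq_sym subr_eq.
  rewrite -additive_of_sigma_additive//.
  - by rewrite setUC setDUK//; exact: subIsetr.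
  - by apply: measurableD => //; exact: measurableI.
  - exact: measurableI.
  - by rewrite setDE -setIA setICl setI0.
  - by rewrite setUC setDUK ?subIsetr//; exact: bS.
- move=> F mF tF gF phi phi1; rewrite setI_bigcupl.
  have phic := contractive_functional_continuous _ phi1.
  have mFD i : measurable (F i `&` D T) by exact: measurableI.
  have tFD : trivIset setT (fun i => F i `&` D T) by exact: trivIset_setIr.
  have bU : bounded_borel (\bigcup_i (F i `&` D T)).
    by rewrite -setI_bigcupl; apply: bSD; exact: bigcup_measurable.
  have h1 : phi (\sum_(0 <= i < n) m (F i `&` D T)) @[n --> \oo] -->
      phi (m (\bigcup_i (F i `&` D T))).
    apply: continuous_cvg; first exact: phic.
    exact: (vsm_sigma_additive mA mFD tFD bU).
  apply: (cvg_unique _ h1) => //.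
  rewrite (_ : (fun n => _) =
      fun n => \sum_(0 <= i < n) functional_measure _ phi1 (F i `&` D T)).
    by apply: (functional_measure_bigcup_cvg T) => // i; exact: subIsetr.
  by apply/funext => n; rewrite linear_sum; apply: eq_bigr => i _; exact: gF.
Qed.

Lemma dominated_vector_stieltjes_measure_null m :
  vector_stieltjes_measure A m -> vector_null_dominates m mu.
Proof.
move=> mA S bS muS; have [T [T0 mS ST]] := bounded_borel_horizon _ bS.
(* Representation is available inside [D T] only; at the origin [m] vanishes by [vsm_zero]. *)
have SE : S = (S `&` [set 0]) `|` (S `&` D T).
  rewrite -setIUr; apply/esym/setIidPl => x /ST.
  rewrite /D /= !in_itv/= le_eqVlt => /andP[/orP[/eqP <-|->] ->]; first by left.
  by right.
have mS0 : m (S `&` [set 0]) = 0.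
  have [S0|S0] := pselect (S 0).
    have -> : S `&` [set 0] = [set 0] by apply/setIidPr => x ->.
    exact: vsm_zero mA.
  rewrite (_ : _ `&` _ = `]0, 0]%classic) ?(vsm_itv mA) ?subrr//.
  by rewrite set_itvoc0; apply/seteqP; split=> // x [Sx x0]; rewrite -x0 in S0.
have mSD : measurable (S `&` D T) by exact: measurableI.
rewrite SE additive_of_sigma_additive -?SE//; last 2 first.
- by apply: measurableI => //; exact: measurable_set1.
- rewrite setIACA setIid; apply/seteqP; split=> // x [_ [-> ]].
  by rewrite /D /= in_itv/= ltxx.
rewrite mS0 add0r; apply/eqP; rewrite -normr_le0.
have := represents_norm_le _ _ (vector_stieltjes_measure_represents _ _ _ mA T0 mS).
rewrite (_ : mu _ = 0%E) ?mulr0//.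
apply/eqP; rewrite eq_le measure_ge0 andbT -[leRHS]muS.
by apply: le_measure; rewrite ?inE//; exact: subIsetl.
Qed.

Lemma dominated_stieltjes_abs_continuous : stieltjes_abs_continuous A mu.
Proof.
split; first exact: dominated_vector_stieltjes_measure_exists.
exact: dominated_vector_stieltjes_measure_null.
Qed.

End dominated_path.

Theorem proposition4p1 (R : realType) (E G : completeNormedModType R)
    (B : {bilinear E -> E -> G}) (pi : nat -> time_partition R)
    (X : R -> E) (QB : R -> G) (Q : R -> R)
    (B_bounded : bounded_bilinear B)
    (X_cadlag : cadlag X)
    (hQB : weak_quadratic_variation B pi X QB)
    (hQ : scalar_quadratic_variation pi X Q)
    (hC : condition_C pi X) :
  (forall s t : R, 0 <= s -> s <= t ->
    `|QB t - QB s| <= bilinear_norm B * (Q t - Q s)) /\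
  stieltjes_abs_continuous QB
    (path_stieltjes_measure (sqv_cadlag hQ) (sqv_nondecreasing hQ)).
Proof.
have [C1 _ C3] := hC.
have QB_le := weak_quadratic_variation_increment_le B pi X QB Q B_bounded
  X_cadlag hQB hQ C1 C3.
split => //.
exact: (dominated_stieltjes_abs_continuous _ _ _ _ _ (wqv_cadlag hQB) QB_le).
Qed.
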